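(* Let $G_1$ be the graph with vertex set $\{u_1,u_2,u_3,u_4,v_1,v_2,v_3,v_4,v_5,v_6,v_7\}$ whose edges are the four edges of the cycle $u_1u_2u_3u_4u_1$, the seven edges of the cycle $v_1v_2v_3v_4v_5v_6v_7v_1$, and the five edges $u_1v_1$, $u_2v_3$, $u_3v_4$, $u_4v_6$, $v_2v_5$. Then $G_1$ is subcubic, planar, and has girth $4$, and $G_1$ has no $(1,2^5)$-packing edge-coloring.
   Context: A graph is subcubic if its maximum degree is at most $3$. The girth of a graph is the length of a shortest cycle. For distinct edges $e,f$ of $G$, the distance between $e$ and $f$ is the distance between the corresponding vertices of the line graph $L(G)$ (so edges sharing an endpoint are at distance $1$). A $(1,2^5)$-packing edge-coloring of $G$ is a partition of $E(G)$ into six classes (possibly empty) such that in the first class any two distinct edges are at distance at least $2$ (the class is a matching), and in each of the remaining five classes any two distinct edges are at distance at least $3$ (the class is an induced matching). *)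

(* Defs.v *)
From HB Require Import structures.
From mathcomp Require Import all_boot all_order all_algebra.
From mathcomp Require Import all_classical all_reals all_analysis.

Set Implicit Arguments.
Unset Strict Implicit.
Unset Printing Implicit Defensive.

Import Order.TTheory GRing.Theory Num.Theory.
Import numFieldNormedType.Exports.

Record sgraph := SGraph {
  vertex :> finType;
  adj : rel vertex;
  adj_sym : symmetric adj;
  adj_irr : irreflexive adj }.

Section GraphNotions.
Variable G : sgraph.

Definition degree (x : G) : nat := #|[set y : G | adj x y]|.

Definition max_degree : nat := \max_(x : G) degree x.

Definition subcubic : Prop := max_degree <= 3.

Definition is_cycle (c : seq G) : Prop :=
  [/\ 3 <= size c, uniq c & cycle (@adj G) c].

(* An acyclic graph satisfies [has_girth g] for no g (infinite girth). *)
Definition has_girth (g : nat) : Prop :=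
  (exists2 c, is_cycle c & size c = g) /\
  (forall c, is_cycle c -> g <= size c).

Definition is_walk (x y : G) (p : seq G) : Prop :=
  path (@adj G) x p /\ last x p = y.

(* The walk x :: p has [size p] edges.  Vertices in different components are
   at no distance d (infinite distance). *)
Definition has_dist (x y : G) (d : nat) : Prop :=
  (exists2 p, is_walk x y p & size p = d) /\
  (forall p, is_walk x y p -> d <= size p).

Definition dist_ge (k : nat) (x y : G) : Prop :=
  forall d, has_dist x y d -> k <= d.

Definition edges : {set {set G}} :=
  [set [set p.1; p.2] | p : G * G & adj p.1 p.2].

Definition edge : finType := {e : {set G} | e \in edges}.

Definition line_adj : rel edge :=
  fun e f => (e != f) && (val e :&: val f != finset.set0).

Lemma line_adj_sym : symmetric line_adj.
Proof. by move=> e f; rewrite /line_adj eq_sym finset.setIC. Qed.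

Lemma line_adj_irr : irreflexive line_adj.
Proof. by move=> e; rewrite /line_adj eqxx. Qed.

Definition line_graph : sgraph := SGraph line_adj_sym line_adj_irr.

End GraphNotions.

Section PackingAndPlanarity.
Variable G : sgraph.

(* A partition of the edges into six possibly empty classes is the family of
   fibres of a map to 'I_6; the fibre of [ord0] is the matching class, the other
   five are the induced matchings. *)
Definition packing_edge_coloring_1_2x5 (c : line_graph G -> 'I_6) : Prop :=
  (forall e f, e != f -> c e = ord0 -> c f = ord0 -> dist_ge 2 e f) /\
  (forall i : 'I_6, i != ord0 ->
    forall e f, e != f -> c e = i -> c f = i -> dist_ge 3 e f).

Local Open Scope ring_scope.

(* A drawing in the plane R * R: vertices are distinct points, each edge is a
   simple arc (injective continuous image of [0, 1]) joining its two ends, and the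
   interior of an arc contains no vertex and no point of the interior of another
   arc. *)
Definition is_plane_drawing (R : realType) (pt : G -> R * R)
    (arc : edge G -> R -> R * R) : Prop :=
  [/\ injective pt,
      forall e, {within `[0, 1], continuous (arc e)}%classic /\
        {in `[0, 1] &, injective (arc e)},
      forall e : edge G, exists x y, [/\ val e = [set x; y]%SET,
        arc e 0 = pt x & arc e 1 = pt y],
      forall (e : edge G) x (t : R), t \in `]0, 1[ -> arc e t <> pt x &
      forall (e f : edge G) (s t : R), e != f -> s \in `]0, 1[ ->
        t \in `]0, 1[ ->
        arc e s <> arc f t].

Definition planar (R : realType) : Prop :=
  exists (pt : G -> R * R) (arc : edge G -> R -> R * R), is_plane_drawing pt arc.

End PackingAndPlanarity.

Inductive G1_vertex :=
  | u1 | u2 | u3 | u4 | v1 | v2 | v3 | v4 | v5 | v6 | v7.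

Definition G1_code (x : G1_vertex) : nat :=
  match x with
  | u1 => 0 | u2 => 1 | u3 => 2 | u4 => 3
  | v1 => 4 | v2 => 5 | v3 => 6 | v4 => 7 | v5 => 8 | v6 => 9 | v7 => 10
  end.

Definition G1_vertices : seq G1_vertex :=
  [:: u1; u2; u3; u4; v1; v2; v3; v4; v5; v6; v7].

Lemma G1_codeK : cancel G1_code (nth u1 G1_vertices).
Proof. by case. Qed.

HB.instance Definition _ := Countable.copy G1_vertex (can_type G1_codeK).

Lemma G1_vertices_enum : Finite.axiom G1_vertices.
Proof. by case. Qed.

HB.instance Definition _ := fintype.isFinite.Build G1_vertex G1_vertices_enum.

Definition G1_edge_list : seq (G1_vertex * G1_vertex) :=
  [:: (u1, u2); (u2, u3); (u3, u4); (u4, u1);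
      (v1, v2); (v2, v3); (v3, v4); (v4, v5); (v5, v6); (v6, v7); (v7, v1);
      (u1, v1); (u2, v3); (u3, v4); (u4, v6); (v2, v5)].

Definition G1_adj : rel G1_vertex :=
  fun x y => ((x, y) \in G1_edge_list) || ((y, x) \in G1_edge_list).

Lemma G1_adj_sym : symmetric G1_adj.
Proof. by move=> x y; rewrite /G1_adj orbC. Qed.

Lemma G1_adj_irr : irreflexive G1_adj.
Proof. by case. Qed.

Definition G1 : sgraph := SGraph G1_adj_sym G1_adj_irr.

(* Main.v *)
Require Import Defs.
From mathcomp Require Import all_boot all_order all_algebra.
From mathcomp Require Import all_classical all_reals all_analysis.
From mathcomp Require Import ring.

(** Planarity is witnessed by a straight-line drawing with integer coordinates:
    two segments have disjoint interiors as soon as one of them lies weakly, and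
    not entirely, on one side of the line spanned by the other, so only signs of
    3-point determinants have to be computed.  Non-colourability is an exhaustive
    backtracking search over the 16 edges in which the classes are numbered in the
    order in which they are first used; this removes the 5! symmetries between the
    five induced matchings. *)

Set Implicit Arguments.
Unset Strict Implicit.
Unset Printing Implicit Defensive.

Import Order.TTheory GRing.Theory Num.Theory.
Import numFieldNormedType.Exports.

(** * Exhaustive search for colourings up to renaming of classes *)

Section Backtracking.
Variables (T : eqType) (conflict : nat -> rel T) (k : nat).

(* [a] lists the items already placed, each with the number of its class; the
   classes in use are [0, ..., n - 1], so [n] is the only new class worth trying.
   The conditionals prune the search under call-by-value evaluation, which would
   compute both sides of a boolean conjunction. *)
Fixpoint extendable (n : nat) (a : seq (T * nat)) (s : seq T) : bool :=
  if s is e :: s' then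
    has (fun i =>
           if all (fun p => if p.2 == i then ~~ conflict i e p.1 else true) a
           then extendable (maxn n i.+1) ((e, i) :: a) s' else false)
        (iota 0 (minn n.+1 k))
  else true.

(** A valid colouring traces a branch that the search never prunes, so a failed search refutes it.
    The list [c0 :: ks] holds the colours in order of first use, and a class number is a position in
    it; [c0] keeps number 0 even if no edge has this colour. *)
Lemma extendable_coloring (C : finType) (c0 : C) (col : T -> C) (ks : seq C)
    (a : seq (T * nat)) (s : seq T) :
  #|C| = k ->
  uniq (c0 :: ks) -> uniq (s ++ unzip1 a) ->
  {in a, forall p, p.2 <= size ks /\ col p.1 = nth c0 (c0 :: ks) p.2} ->
  {in s ++ unzip1 a &, forall e f, e != f -> col e = col f ->
     ~~ conflict (if col e == c0 then 0 else 1) e f} ->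
  (forall i, conflict i.+1 =2 conflict 1) ->
  extendable (size ks).+1 a s.
Proof.
move=> cardC; elim: s ks a => [//|e s IHs] ks a uks us colP confP conf1.
rewrite [extendable _ _ _]/=.
have usa : uniq (s ++ unzip1 ((e, 0) :: a)).
  by rewrite (perm_uniq (permEl (perm_catCA s [:: e] (unzip1 a)))).
have memE j : s ++ unzip1 ((e, j) :: a) =i (e :: s) ++ unzip1 a.
  exact/perm_mem/permEl/(perm_catCA s [:: e] (unzip1 a)).
(* The number [i] is the old position of the colour of [e], or the next free one if that colour is
   new; in the latter case [ks'] appends it to [ks]. *)
have [ks' [i [uks' ile sz colks' col_e]]] : exists ks' : seq C, exists i,
    [/\ uniq (c0 :: ks'), i < minn (size ks).+2 k,
        (size ks').+1 = maxn (size ks).+1 i.+1,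
        (forall j, j <= size ks -> nth c0 (c0 :: ks') j = nth c0 (c0 :: ks) j)
      & col e = nth c0 (c0 :: ks') i].
  have leC (l : seq C) : uniq l -> size l <= k.
    by move=> ul; rewrite -cardC -(card_uniqP ul) max_card.
  have [eks|eks] := boolP (col e \in c0 :: ks).
    exists ks, (index (col e) (c0 :: ks)).
    have lti : index (col e) (c0 :: ks) < size (c0 :: ks) by rewrite index_mem.
    split=> //; last by rewrite nth_index.
    - by rewrite leq_min (leqW lti) (leq_trans lti (leC _ uks)).
    - by apply/esym/maxn_idPl.
  exists (rcons ks (col e)), (size ks).+1.
  have u' : uniq (c0 :: rcons ks (col e)) by rewrite -rcons_cons rcons_uniq eks.
  split=> //.
  - by rewrite leq_min leqnn; have := leC _ u'; rewrite /= size_rcons.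
  - by rewrite size_rcons; apply/esym/maxn_idPr.
  - by move=> j jle; rewrite -rcons_cons nth_rcons ltnS jle.
  - by rewrite -rcons_cons nth_rcons /= ltnn eqxx.
have szle : size ks <= size ks' by rewrite -ltnS sz leq_maxl.
have lei : i <= size ks' by rewrite -ltnS sz leq_maxr.
apply/hasP; exists i; first by rewrite mem_iota.
(* Number 0 means exactly colour [c0], so the search and the colouring use the same conflict
   relation. *)
have c0E j : j <= size ks' -> (nth c0 (c0 :: ks') j == c0) = (j == 0).
  by move=> jle; rewrite -[X in _ == X]/(nth c0 (c0 :: ks') 0) nth_uniq.
case: ifPn => [_|/negP[]].
  rewrite -sz; apply: IHs => //; last by move=> f g; rewrite !memE; apply: confP.
  move=> [f j]; rewrite inE => /orP[/eqP[-> ->]//|fa].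
  have [/= jle colf] := colP _ fa.
  by rewrite (leq_trans jle szle) colks'.
apply/allP=> -[f j] fa /=; case: eqP => // ji; subst j.
have [/= ilek colf] := colP _ fa.
have fin : f \in unzip1 a by apply/mapP; exists (f, i).
have nef : e != f.
  by apply: contraTneq us => ->; rewrite /= mem_cat fin orbT.
have colef : col e = col f by rewrite col_e colf colks'.
have := confP e f; rewrite mem_head inE mem_cat fin !orbT => /(_ isT isT nef colef).
rewrite col_e c0E //.
by case: i {ile sz lei col_e fa ilek colf c0E fin} => //= i; rewrite conf1.
Qed.

End Backtracking.

(** * Distances in the line graph *)

(** Since [dist_ge] only constrains a distance that exists, one is produced as the least length of a
    walk from [x] to [y]. *)
Lemma dist_ge_walk (G : sgraph) (k : nat) (x y : G) (p : seq G) :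
  dist_ge k x y -> is_walk x y p -> k <= size p.
Proof.
move=> kxy wp.
pose P n := `[< exists2 q, is_walk x y q & size q = n >].
have exP : exists n, P n by exists (size p); apply/asboolP; exists p.
case: (ex_minnP exP) => d /asboolP dP dmin.
have minp q : is_walk x y q -> d <= size q.
  by move=> wq; apply: dmin; apply/asboolP; exists q.
by apply: leq_trans (kxy d _) (minp _ wp); split.
Qed.

Lemma adj_dist_lt2 (G : sgraph) (x y : G) : adj x y -> ~ dist_ge 2 x y.
Proof.
move=> xy /(@dist_ge_walk _ _ _ _ [:: y])/=.
by rewrite /is_walk /= xy => /(_ (conj isT erefl)).
Qed.

Lemma adj2_dist_lt3 (G : sgraph) (x y z : G) :
  adj x y -> adj y z -> ~ dist_ge 3 x z.
Proof.
move=> xy yz /(@dist_ge_walk _ _ _ _ [:: y; z])/=.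
by rewrite /is_walk /= xy yz => /(_ (conj isT erefl)).
Qed.

Section Distance.
Variable G : sgraph.

Lemma mem_edges (x y : G) : adj x y -> [set x; y]%SET \in edges G.
Proof. by move=> xy; apply/imsetP; exists (x, y); rewrite ?inE. Qed.

(** Tests on pairs of endpoints, so that the search evaluates without forming sets. *)
Definition meets (p q : G * G) : bool :=
  [|| p.1 == q.1, p.1 == q.2, p.2 == q.1 | p.2 == q.2].

Definition linked (p q : G * G) : bool :=
  [|| adj p.1 q.1, adj p.1 q.2, adj p.2 q.1 | adj p.2 q.2].

Lemma line_adjI (e f : line_graph G) (x : G) :
  e != f -> x \in val e -> x \in val f -> adj e f.
Proof.
move=> nef xe xf; apply/andP; split=> //.
by apply/finset.set0Pn; exists x; rewrite finset.inE xe.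
Qed.

Lemma meets_adj (e f : line_graph G) (p q : G * G) :
  val e = [set p.1; p.2]%SET -> val f = [set q.1; q.2]%SET -> e != f ->
  meets p q -> adj e f.
Proof.
move=> eE fE nef /or4P[] /eqP pq;
  [apply: (line_adjI (x := p.1))|apply: (line_adjI (x := p.1))|
   apply: (line_adjI (x := p.2))|apply: (line_adjI (x := p.2))] => //;
  by rewrite ?eE ?fE ?pq !finset.inE eqxx ?orbT.
Qed.

(** The edge [xy] is the middle vertex of a walk of length 2 from [e] to [f], unless it equals one
    of them; then [e] and [f] share an endpoint. *)
Lemma joined_dist_lt3 (e f : line_graph G) (x y : G) :
  e != f -> x \in val e -> y \in val f -> adj x y -> ~ dist_ge 3 e f.
Proof.
move=> nef xe yf xy d3.
have not_adj : ~ adj e f.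
  by move/adj_dist_lt2; apply=> d /d3; apply: ltnW.
pose g : line_graph G := exist _ [set x; y]%SET (mem_edges xy).
have xg : x \in val g by rewrite /= !finset.inE eqxx.
have yg : y \in val g by rewrite /= !finset.inE eqxx orbT.
have [eg|neg] := eqVneq e g.
  by apply/not_adj/(@line_adjI _ _ y); rewrite // eg.
have [gf|ngf] := eqVneq g f.
  by apply/not_adj/(@line_adjI _ _ x); rewrite // -gf.
exact: adj2_dist_lt3 (line_adjI neg xe xg) (line_adjI ngf yg yf) d3.
Qed.

Lemma linked_dist_lt3 (e f : line_graph G) (p q : G * G) :
  val e = [set p.1; p.2]%SET -> val f = [set q.1; q.2]%SET -> e != f ->
  linked p q -> ~ dist_ge 3 e f.
Proof.
move=> eE fE nef /or4P[] pq; apply: joined_dist_lt3 pq => //;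
  by rewrite ?eE ?fE !finset.inE eqxx ?orbT.
Qed.

End Distance.

(** * Degree and girth of [G1] *)

Lemma G1_subcubic : subcubic G1.
Proof.
apply/bigmax_leqP=> x _; rewrite /degree cardsE cardE /enum_mem size_filter.
by rewrite [Finite.enum]unlock; case: x.
Qed.

Lemma G1_triangle_free (x y z : G1) : adj x y -> adj y z -> ~~ adj z x.
Proof.
move: x y z.
have : all (fun x => all (fun y => all (fun z =>
    ~~ [&& G1_adj x y, G1_adj y z & G1_adj z x]) G1_vertices) G1_vertices)
    G1_vertices by vm_compute.
have memG x : x \in G1_vertices by case: x.
move=> /allP h x y z; have /allP/(_ y (memG y))/allP/(_ z (memG z)) := h x (memG x).
by rewrite /= => + xy yz; rewrite xy yz.
Qed.

Lemma G1_girth : has_girth G1 4.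
Proof.
split; first by exists ([:: u1; u2; u3; u4] : seq G1).
move=> c [c3 uc cc]; rewrite ltn_neqAle c3 andbT; apply/eqP.
case: c cc {c3 uc} => [|x [|y [|z [|]]]] //= /and4P[xy yz zx _] _.
exact: negP (G1_triangle_free xy yz) zx.
Qed.

(** * Non-colourability of [G1] *)

(* A reordering of [G1_edge_list] found by local search: the search tree has
   about 1000 nodes, against 10000 for the original order. *)
Definition G1_search_order : seq (G1 * G1) :=
  [:: (v2, v5); (v4, v5); (v5, v6); (v2, v3); (v3, v4); (v1, v2); (u2, v3);
      (u3, v4); (u2, u3); (u1, u2); (u3, u4); (u1, v1); (u4, u1); (u4, v6);
      (v6, v7); (v7, v1)].

Definition G1_conflict (i : nat) (p q : G1 * G1) : bool :=
  if i is 0 then meets p q else meets p q || linked p q.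

Lemma G1_search_fails : extendable G1_conflict 6 1 [::] G1_search_order = false.
Proof. by vm_compute. Qed.

(** Replaces equality of sets by a boolean that can be evaluated on concrete pairs. *)
Lemma set2_eq (T : finType) (p q : T * T) :
  [set p.1; p.2]%SET = [set q.1; q.2]%SET ->
  [&& q.1 \in [:: p.1; p.2], q.2 \in [:: p.1; p.2],
      p.1 \in [:: q.1; q.2] & p.2 \in [:: q.1; q.2]].
Proof.
move=> /setP pq.
have := (pq q.1, pq q.2, pq p.1, pq p.2).
by rewrite !finset.inE !eqxx ?orbT /= => -[[[-> ->] <-] <-].
Qed.

Lemma G1_edge_list_inj :
  {in G1_edge_list &, injective (fun p : G1 * G1 => [set p.1; p.2]%SET)}.
Proof.
move=> p q pL qL /set2_eq pq; apply/eqP; move: pq.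
have /allP/(_ p pL)/allP/(_ q qL)/implyP := (isT : all (fun p => all (fun q =>
  [&& q.1 \in [:: p.1; p.2], q.2 \in [:: p.1; p.2],
      p.1 \in [:: q.1; q.2] & p.2 \in [:: q.1; q.2]] ==> (p == q)) G1_edge_list) G1_edge_list).
exact.
Qed.

Lemma G1_not_colorable (c : line_graph G1 -> 'I_6) :
  ~ packing_edge_coloring_1_2x5 c.
Proof.
move=> [c0P ciP].
(* The default edge [u1 u2] is never reached on pairs from the search order. *)
pose ed (p : G1 * G1) : edge G1 := 
  insubd (exist (fun e => e \in edges G1) _ (@mem_edges G1 u1 u2 isT)) [set p.1; p.2]%SET.
have subL : {subset G1_search_order <= G1_edge_list}.
  by apply/allP; vm_compute.
have edE p : p \in G1_search_order -> val (ed p) = [set p.1; p.2]%SET.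
  move=> /subL pL; rewrite insubdK //; apply: mem_edges.
  by rewrite /= /G1_adj -surjective_pairing pL.
have/negP := negbT G1_search_fails; apply.
(* Initially only the matching class [ord0] is numbered, hence the empty [ks] and the search
   parameter 1. *)
apply: (@extendable_coloring _ _ _ _ (@ord0 5) (c \o ed) [::]) => //.
- by rewrite card_ord.
rewrite cats0 => p q pL qL npq /= cpq.
have nef : ed p != ed q.
  apply: contraNneq npq => /(congr1 val); rewrite !edE // => /G1_edge_list_inj.
  by move=> -> //; apply: subL.
case: eqP => [cp|/eqP cp]; apply/negP => /=.
  by move/(meets_adj (edE _ pL) (edE _ qL) nef)/adj_dist_lt2; apply; apply: c0P;
    rewrite -?cpq.
have d3 := ciP _ cp _ _ nef erefl (esym cpq).
move=> /orP[/(meets_adj (edE _ pL) (edE _ qL) nef) pq|].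
  by apply: adj_dist_lt2 pq _ => d /d3; apply: ltnW.
by move/(linked_dist_lt3 (edE _ pL) (edE _ qL) nef).
Qed.

(** * Planarity from integer straight-line drawings *)

Section StraightLineDrawing.
Local Open Scope ring_scope.

(** Twice the signed area of the triangle [p q r]. *)
Definition orient (R : pzRingType) (p q r : R * R) : R :=
  (q.1 - p.1) * (r.2 - p.2) - (q.2 - p.2) * (r.1 - p.1).

Definition segment (R : pzRingType) (p q : R * R) (t : R) : R * R :=
  (p.1 + t * (q.1 - p.1), p.2 + t * (q.2 - p.2)).

(** The weak inequality admits segments with a common endpoint, where a determinant vanishes. *)
Definition one_side (R : numDomainType) (p q r s : R * R) : bool :=
  (0 <= orient p q r * orient p q s) &&
  ((orient p q r != 0) || (orient p q s != 0)).

Definition intr_pt (R : pzRingType) (p : int * int) : R * R := (p.1%:~R, p.2%:~R).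

Lemma orient_intr (R : pzRingType) (p q r : int * int) :
  orient (intr_pt R p) (intr_pt R q) (intr_pt R r) = (orient p q r)%:~R.
Proof. by rewrite /orient !(rmorphB, rmorphM). Qed.

Lemma one_side_intr (R : numDomainType) (p q r s : int * int) :
  one_side (intr_pt R p) (intr_pt R q) (intr_pt R r) (intr_pt R s) =
  one_side p q r s.
Proof. by rewrite /one_side !orient_intr -intrM ler0z !intr_eq0. Qed.

Lemma orient_segment (R : comPzRingType) (p q : R * R) (t : R) :
  orient p q (segment p q t) = 0.
Proof. by rewrite /orient /segment /=; ring. Qed.

Lemma orient_segmentE (R : comPzRingType) (p q r s : R * R) (t : R) :
  orient p q (segment r s t) = (1 - t) * orient p q r + t * orient p q s.
Proof. by rewrite /orient /segment /=; ring. Qed.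

Lemma segment0 (R : pzRingType) (p q : R * R) : segment p q 0 = p.
Proof. by rewrite /segment !mul0r !addr0 -surjective_pairing. Qed.

Lemma segment1 (R : pzRingType) (p q : R * R) : segment p q 1 = q.
Proof. by rewrite /segment !mul1r !subrKC -surjective_pairing. Qed.

Lemma segment_inj (R : idomainType) (p q : R * R) :
  p != q -> injective (segment p q).
Proof.
move=> npq s t [/addrI e1 /addrI e2]; apply: contraNeq npq => nst.
have cancel (a b : R) : s * (b - a) = t * (b - a) -> a = b.
  move/eqP; rewrite -subr_eq0 -mulrBl mulf_eq0 subr_eq0 (negPf nst) /=.
  by rewrite subr_eq0 => /eqP.
apply/eqP; rewrite [p]surjective_pairing [q]surjective_pairing.
by rewrite (cancel _ _ e1) (cancel _ _ e2).
Qed.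

(** The function [orient p q] vanishes on the first segment; inside the second it is a combination,
    with positive weights, of two end values of weakly equal sign that are not both zero. *)
Lemma one_side_disjoint (R : realDomainType) (p q r s : R * R) (x y : R) :
  one_side p q r s -> y \in `]0, 1[ -> segment p q x <> segment r s y.
Proof.
move=> /andP[ge0 ne0]; rewrite in_itv /= => /andP[y0 y1] /(congr1 (orient p q)).
rewrite orient_segment orient_segmentE => /esym/eqP eq0.
set a := orient p q r in ge0 ne0 eq0; set b := orient p q s in ge0 ne0 eq0.
have y'0 : 0 < 1 - y by rewrite subr_gt0.
have {}eq0 : (1 - y) * a = - (y * b) by apply/eqP; rewrite -addr_eq0.
(* If the combination vanishes, the square of [(1 - y) * a] equals [- ((1 - y) * y * (a * b))],
   which is at most 0; so [a], and then [b], is zero. *)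
move: ne0; have : ((1 - y) * a) ^+ 2 <= 0.
  rewrite expr2 {2}eq0 mulrN oppr_le0.
  have -> : (1 - y) * a * (y * b) = (1 - y) * y * (a * b) by ring.
  by apply: mulr_ge0 => //; rewrite mulr_ge0 ?ltW.
rewrite le_eqVlt ltNge sqr_ge0 orbF sqrf_eq0 => /eqP a0; move: (a0).
move/eqP; rewrite mulf_eq0 (gt_eqF y'0) /= => ->/=.
by move: eq0; rewrite a0 => /esym/eqP; rewrite oppr_eq0 mulf_eq0 (gt_eqF y0) /= => ->.
Qed.

Lemma segment_continuous (R : realType) (p q : R * R) : continuous (segment p q).
Proof.
have affine_cont (a b : R) : continuous (fun t : R => a + t * b).
  by move=> t; apply: cvgD; [exact: cvg_cst|apply: cvgM; [exact: cvg_id|exact: cvg_cst]].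
by move=> t; exact: cvg_pair (affine_cont _ _ t) (affine_cont _ _ t).
Qed.

(** All conditions on [pt] are integer computations. Other vertices are kept off the whole line
    through an edge, which one determinant decides. *)
Lemma straight_line_planar (R : realType) (G : sgraph) (L : seq (G * G))
    (pt : G -> int * int) :
  (forall x y, adj x y -> ((x, y) \in L) || ((y, x) \in L)) ->
  injective pt -> {in L, forall p, p.1 != p.2} ->
  {in L, forall p, forall x, x \in [:: p.1; p.2] \/
     orient (pt p.1) (pt p.2) (pt x) != 0} ->
  {in L &, forall p q, p != q ->
     one_side (pt p.1) (pt p.2) (pt q.1) (pt q.2) ||
     one_side (pt q.1) (pt q.2) (pt p.1) (pt p.2)} ->
  planar G R.
Proof.
move=> adjL pt_inj irrL offL sepL.
(* Edges are unordered, so an orientation occurring in [L] is chosen for each. *)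
have endsP (e : edge G) :
    {p : G * G | p \in L & val e = [set p.1; p.2]%SET}.
  apply: cid2; case: e => _ /= /imsetP[[x y] + ->]; rewrite finset.inE /= => xy.
  have /orP[xyL|yxL] := adjL _ _ xy; first by exists (x, y).
  by exists (y, x); rewrite // finset.setUC.
pose ends e := s2val (endsP e).
have endsL e : ends e \in L by rewrite /ends; case: (endsP e).
have endsE e : val e = [set (ends e).1; (ends e).2]%SET by rewrite /ends; case: (endsP e).
pose P x := intr_pt R (pt x).
have P_inj : injective P.
  move=> x y [/intr_inj x1 /intr_inj x2]; apply: pt_inj.
  by rewrite [pt x]surjective_pairing x1 x2 -surjective_pairing.
have P_ends e : P (ends e).1 != P (ends e).2.
  by rewrite inj_eq // irrL.
exists P, (fun e => segment (P (ends e).1) (P (ends e).2)); split=> //.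
- move=> e; split; first exact/continuous_subspaceT/segment_continuous.
  by move=> s t _ _; apply: segment_inj.
- by move=> e; exists (ends e).1, (ends e).2; rewrite segment0 segment1.
- move=> e x t; rewrite in_itv /= => /andP[t0 t1] etx.
  (* An endpoint is already attained at parameter 0 or 1, so injectivity excludes it from the
     interior. *)
  have [|] := offL _ (endsL e) x.
    rewrite !inE => /orP[]/eqP xE; move: etx; rewrite xE.
      rewrite -[in RHS](segment0 (P (ends e).1) (P (ends e).2)).
      by move/(segment_inj (P_ends e)) => t00; rewrite t00 ltxx in t0.
    rewrite -[in RHS](segment1 (P (ends e).1) (P (ends e).2)).
    by move/(segment_inj (P_ends e)) => t11; rewrite t11 ltxx in t1.
  by rewrite -(intr_eq0 R) -orient_intr -/(P x) -etx orient_segment eqxx.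
- move=> e f s t nef s01 t01.
  have nends : ends e != ends f.
    by apply: contraNneq nef => ef; rewrite -val_eqE endsE ef -endsE.
  have /orP[] := sepL _ _ (endsL e) (endsL f) nends; rewrite -(one_side_intr R).
    by move/one_side_disjoint; apply.
  by move/one_side_disjoint => dis /esym; apply: dis.
Qed.

End StraightLineDrawing.

(** The 4-cycle lies inside the 7-cycle, whose side [v3 v4] is dented inwards so that the chord
    [v2 v5] passes outside as a straight segment. *)
Definition G1_point (x : G1) : int * int :=
  match x with
  | u1 => (3, 11)%Z | u2 => (4, 13)%Z | u3 => (5, 13)%Z | u4 => (6, 11)%Z
  | v1 => (0, 9)%Z | v2 => (0, 18)%Z | v3 => (3, 16)%Z | v4 => (6, 16)%Z
  | v5 => (9, 18)%Z | v6 => (9, 9)%Z | v7 => (4, 0)%Z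
  end.

Lemma G1_planar (R : realType) : planar G1 R.
Proof.
apply: (@straight_line_planar R G1 G1_edge_list G1_point) => //.
- by do 2!case.
- by apply/allP.
- move=> p pL x; apply/orP; move: p pL x.
  have h : all (fun p => all (fun x => (x \in [:: p.1; p.2]) ||
    (orient (G1_point p.1) (G1_point p.2) (G1_point x) != 0)%R)
    G1_vertices) G1_edge_list by vm_compute.
  by move=> p /(allP h)/allP + x; apply; case: x.
- have h : all (fun p => all (fun q => (p != q) ==>
     one_side (G1_point p.1) (G1_point p.2) (G1_point q.1) (G1_point q.2) ||
     one_side (G1_point q.1) (G1_point q.2) (G1_point p.1) (G1_point p.2))
    G1_edge_list) G1_edge_list by vm_compute.
  by move=> p q /(allP h)/allP/[apply]/implyP.
Qed.

Theorem mainTheorem5 (R : realType) :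
  [/\ subcubic G1,
      planar G1 R,
      has_girth G1 4 &
      ~ exists c : line_graph G1 -> 'I_6, packing_edge_coloring_1_2x5 c].
Proof.
split; [exact: G1_subcubic|exact: G1_planar|exact: G1_girth|].
by case=> c; apply: G1_not_colorable.
Qed.
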